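(* Let $q\in[0,2)$, $s'>0$, $\beta>2$ and $\delta\in(0,1)$. Consider the model $\mathbf{Y}=\boldsymbol{\Theta}+\mathbf{E}$, where $\boldsymbol{\Theta}\in\mathbb{R}^{p\times r}$ is deterministic and $\mathbf{E}$ has i.i.d. $N(0,1)$ entries. Let $\widehat{\boldsymbol{\Theta}}=\operatorname{argmin}_{\boldsymbol{\Theta}\in\mathbb{R}^{p\times r}}\{\|\mathbf{Y}-\boldsymbol{\Theta}\|_{\mathrm F}^2+\operatorname{pen}(\boldsymbol{\Theta})\}$. Then there is a constant $C>0$ depending only on $q,\beta,\delta$ such that \[ \sup_{\boldsymbol{\Theta}\in\mathcal{F}_q(s',p)}\mathsf{E}\|\widehat{\boldsymbol{\Theta}}-\boldsymbol{\Theta}\|_{\mathrm F}^2\le Ck'\Bigl(r+\log\frac{\mathrm{e}p}{k'}\Bigr), \] where $k'=\min\{k\in[p]: t_k^{q/2}k\ge s'\}$, and $k'=p$ if this set is empty.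
   Context: For $k\in[p]$, $t_k=r+\sqrt{2r\beta\log\frac{\mathrm{e}p}{k}}+\beta\log\frac{\mathrm{e}p}{k}$; $\operatorname{pen}(k)=(1+\delta)^2\sum_{i=1}^k t_i$ (with $\operatorname{pen}(0)=0$), and $\operatorname{pen}(\boldsymbol{\Theta})=\operatorname{pen}(|\operatorname{supp}(\boldsymbol{\Theta})|)$, where $\operatorname{supp}(\boldsymbol{\Theta})$ is the set of indices of nonzero rows. Weak-$\ell_q$ radius: with row norms sorted decreasingly $\|\boldsymbol{\Theta}_{(1)*}\|\ge\dots\ge\|\boldsymbol{\Theta}_{(p)*}\|$, $\|\boldsymbol{\Theta}\|_{q,w}=\max_{j\in[p]}j\|\boldsymbol{\Theta}_{(j)*}\|^q$ (for $q=0$, the number of nonzero rows); $\mathcal{F}_q(s',p)=\{\boldsymbol{\Theta}\in\mathbb{R}^{p\times r}:\|\boldsymbol{\Theta}\|_{q,w}\le s'\}$. *)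

(* Defs.v *)
From HB Require Import structures.
From mathcomp Require Import all_boot all_order all_algebra.
From mathcomp Require Import all_classical all_reals all_analysis.
Set Implicit Arguments. Unset Strict Implicit. Unset Printing Implicit Defensive.
Import Order.TTheory GRing.Theory Num.Theory.
Local Open Scope classical_set_scope.
Local Open Scope ring_scope.

Section Defs.
Variable R : realType.

Definition frob2 (p r : nat) (A : 'M[R]_(p, r)) : R :=
  \sum_(i < p) \sum_(j < r) A i j ^+ 2.

Definition rownorm (p r : nat) (A : 'M[R]_(p, r)) (i : 'I_p) : R :=
  Num.sqrt (\sum_(j < r) A i j ^+ 2).

Definition supp (p r : nat) (A : 'M[R]_(p, r)) : {set 'I_p} :=
  [set i | row i A != 0].

(* t_k, for k in [p] (1-indexed) *)
Definition tk (p r : nat) (beta : R) (k : nat) : R :=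
  r%:R + Num.sqrt (2 * r%:R * beta * ln (expR 1 * p%:R / k%:R))
       + beta * ln (expR 1 * p%:R / k%:R).

Definition pen (p r : nat) (beta delta : R) (k : nat) : R :=
  (1 + delta) ^+ 2 * \sum_(1 <= i < k.+1) tk p r beta i.

Definition penM (p r : nat) (beta delta : R) (A : 'M[R]_(p, r)) : R :=
  pen p r beta delta #|supp A|.

Definition sorted_rownorms (p r : nat) (A : 'M[R]_(p, r)) : seq R :=
  sort (fun x y : R => y <= x) [seq rownorm A i | i <- enum 'I_p].

Definition weak_lq (q : R) (p r : nat) (A : 'M[R]_(p, r)) : R :=
  if q == 0 then #|supp A|%:R
  else \big[Num.max/0]_(j < p)
         ((j.+1)%:R * (nth 0 (sorted_rownorms A) j) `^ q).

Definition Fq (q s' : R) (p r : nat) : set 'M[R]_(p, r) :=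
  [set A | weak_lq q A <= s'].

Definition kprime (q s' beta : R) (p r : nat) : nat :=
  head p [seq k <- iota 1 p | s' <= (tk p r beta k) `^ (q / 2) * k%:R].

Definition is_pen_minimizer (p r : nat) (beta delta : R)
    (Y Th : 'M[R]_(p, r)) : Prop :=
  forall Th' : 'M[R]_(p, r),
    frob2 (Y - Th) + penM beta delta Th <= frob2 (Y - Th') + penM beta delta Th'.

Definition iid_std_gaussian d (T : measurableType d) (P : probability T R)
    (p r : nat) (E : 'I_p -> 'I_r -> T -> R) : Prop :=
  (forall i j, measurable_fun setT (E i j)) /\
  (forall i j (A : set R), measurable A ->
     P (E i j @^-1` A) = normal_prob 0 1 A) /\
  (forall B : 'I_p -> 'I_r -> set R, (forall i j, measurable (B i j)) ->
     P (\bigcap_(ij in [set: 'I_p * 'I_r]) (E ij.1 ij.2 @^-1` B ij.1 ij.2))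
     = (\prod_(i < p) \prod_(j < r) P (E i j @^-1` B i j))%E).

End Defs.

(* Main.v *)
Require Import Defs.
From HB Require Import structures.
From mathcomp Require Import all_boot all_order all_algebra.
From mathcomp Require Import all_classical all_reals all_analysis.
From mathcomp Require Import measurable_realfun ring lra.
Set Implicit Arguments. Unset Strict Implicit. Unset Printing Implicit Defensive.
Import Order.TTheory GRing.Theory Num.Theory.
Local Open Scope classical_set_scope.
Local Open Scope ring_scope.

(** Write [|A_S|^2] for the squared norm of the rows of [A] indexed by [S]. Comparing
the minimizer with the row restrictions of [Y] shows that it equals [Y] on its own
support [S], and that for every set [S'] of rows
[|Y_{S'\S}|^2 + pen |S| <= |Y_{S\S'}|^2 + pen |S'|].
Put [T_k = t_1 + ... + t_k], so that [pen k = (1 + delta)^2 T_k]. If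
[|E_S|^2 <= T_|S| + W], the spare factor [1 + delta] of the penalty absorbs the
noise and the loss is at most a constant times
[W + |Th_{S'^c}|^2 + pen |S'| + |E_{S'}|^2].
Since [t] is decreasing, [k t_k <= T_k], and [k t_k] is a chi-square deviation
threshold for [k r] degrees of freedom at level [exp (- k beta L_k / 2)], with
[L_k = ln (e p / k)]. As there are at most [exp (k L_k)] sets of [k] rows and
[beta > 2], the sum over all [S] of the exponential (Chernoff) excesses has
expectation [O(r)] and can serve as [W].
Finally [S'] is the set of rows of [Th] with squared norm above [t_k'], which has at
most [k'] elements; the weak-l_q bound and the choice of [k'] make the remaining rows
contribute [O(k' t_k')]. *)

(** * Product formula for independent variables *)

Section density.
Import HBNNSimple.
Local Open Scope ereal_scope.

Lemma ge0_integral_density d1 d2 (X : measurableType d1) (Y : measurableType d2)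
    (R : realType) (mu : {measure set X -> \bar R})
    (nu : {measure set Y -> \bar R}) (phi : X -> Y) (g : X -> R) (c : R)
    (f : Y -> R) :
  measurable_fun setT phi -> measurable_fun setT g -> (forall x, 0 <= g x)%R ->
  (0 <= c)%R ->
  (forall B, measurable B ->
     \int[mu]_x (\1_B (phi x) * g x)%:E = c%:E * nu B) ->
  measurable_fun setT f -> (forall y, 0 <= f y)%R ->
  \int[mu]_x (f (phi x) * g x)%:E = c%:E * \int[nu]_y (f y)%:E.
Proof.
move=> mphi mg g0 c0 Hind mf f0.
have mfE : measurable_fun setT (fun y => (f y)%:E) by exact/measurable_EFinP.
pose f_ n := nnsfun_approx measurableT mfE n.
have fE0 x : [set: Y] x -> 0 <= (f x)%:E by rewrite lee_fin.
have f_cvg y : EFin \o f_^~ y @ \oo --> (f y)%:E by exact: cvg_nnsfun_approx.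
have f_nd y m n : (m <= n)%N -> (f_ m y <= f_ n y)%R.
  by move=> mn; exact/lefP/nd_nnsfun_approx.
have mphi_ (h : Y -> R) : measurable_fun setT h ->
    measurable_fun setT (fun x => (h (phi x) * g x)%:E).
  move=> mh; apply/measurable_EFinP/measurable_funM => //.
  exact: measurableT_comp.
have key n : \int[mu]_x (f_ n (phi x) * g x)%:E = c%:E * \int[nu]_y (f_ n y)%:E.
  have mset k : measurable (f_ n @^-1` [set k]) by [].
  have fg0 k x : 0 <= (k * \1_(f_ n @^-1` [set k]) (phi x) * g x)%:E.
    rewrite EFinM mule_ge0 ?lee_fin//.
    exact: nnfun_muleindic_ge0.
  transitivity (\int[mu]_x (\sum_(k \in range (f_ n))
      (k * \1_(f_ n @^-1` [set k]) (phi x) * g x)%:E)).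
    apply: eq_integral => x _; rewrite fimfunE EFinM -fsumEFin//.
    rewrite ge0_mule_fsuml; last by move=> k; exact: nnfun_muleindic_ge0.
    by apply: eq_fsbigr => k _; rewrite -EFinM.
  rewrite ge0_integral_fsum//; last first.
    move=> k; apply: (mphi_ (fun y => k * \1_(f_ n @^-1` [set k]) y)%R).
    exact: measurable_funM.
  under [in RHS]eq_integral do rewrite fimfunE -fsumEFin//.
  rewrite [in RHS]ge0_integral_fsum//; last 2 first.
  - by move=> r; exact/measurable_EFinP/measurable_funM.
  - by move=> r x _; rewrite nnfun_muleindic_ge0.
  rewrite ge0_mule_fsumr; last first.
    by move=> k; apply: integral_ge0 => y _; exact: nnfun_muleindic_ge0.
  apply: eq_fsbigr => k kr.
  have k0 : (0 <= k)%R by move: kr; rewrite inE => -[y _ <-].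
  rewrite integralZl_indic_nnsfun// integral_indic// setIT muleCA.
  rewrite -Hind// -ge0_integralZl_EFin//.
  - by apply: eq_integral => x _; rewrite -EFinM mulrA.
  - by move=> x _; rewrite lee_fin mulr_ge0.
  - by apply: mphi_.
have H1 : \int[mu]_x (f_ n (phi x) * g x)%:E @[n --> \oo] -->
    \int[mu]_x (f (phi x) * g x)%:E.
  have := @cvg_monotone_convergence _ _ _ mu setT measurableT
    (fun n x => (f_ n (phi x) * g x)%:E).
  rewrite (@eq_integral _ _ _ mu setT (fun x => (f (phi x) * g x)%:E)).
    apply.
    - by move=> n; apply: mphi_.
    - by move=> n x _; rewrite lee_fin mulr_ge0.
    - by move=> x _ m n mn; rewrite lee_fin ler_wpM2r// f_nd.
  move=> x _; apply/cvg_lim => //.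
  rewrite EFinM; under eq_fun do rewrite EFinM.
  by apply: cvgeZr => //; exact: f_cvg.
have H2 : \int[nu]_y (f_ n y)%:E @[n --> \oo] --> \int[nu]_y (f y)%:E.
  have := @cvg_monotone_convergence _ _ _ nu setT measurableT
    (fun n x => (f_ n x)%:E).
  rewrite (@eq_integral _ _ _ nu setT (fun x => (f x)%:E)).
    apply.
    - by move=> n; exact/measurable_EFinP.
    - by move=> n x _; rewrite lee_fin.
    - by move=> x _ m n mn; rewrite lee_fin f_nd.
  by move=> x _; apply/cvg_lim => //; exact: f_cvg.
rewrite (funext key : _ = (fun n => c%:E * \int[nu]_y (f_ n y)%:E)) in H1.
by apply: (cvg_unique _ H1) => //; exact: cvgeZl.
Qed.

End density.

Section independence.
Local Open Scope ereal_scope.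

(* The factors are replaced one at a time: [A] contains the indices whose factor is
   not yet known to be an indicator, and freeing one factor is a density argument. *)
Lemma integral_prod_indep d d' (T : measurableType d) (Y : measurableType d')
    (R : realType) (P : probability T R) (nu : {measure set Y -> \bar R})
    (I : finType) (X : I -> T -> Y) (F : I -> Y -> R) (e : I -> R) :
  (forall i, measurable_fun setT (X i)) ->
  (forall B : I -> set Y, (forall i, measurable (B i)) ->
     P (\bigcap_(i in [set: I]) (X i @^-1` B i)) = \prod_i nu (B i)) ->
  (forall B, measurable B -> nu B \is a fin_num) ->
  (forall i, measurable_fun setT (F i)) -> (forall i x, 0 <= F i x)%R ->
  (forall i, \int[nu]_x (F i x)%:E = (e i)%:E) ->
  \int[P]_w (\prod_i F i (X i w))%:E = (\prod_i e i)%:E.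
Proof.
move=> mX indep nufin.
suff main n (A : {set I}) (G : I -> Y -> R) (h : I -> R) : #|A| = n ->
    (forall i, i \notin A -> exists2 B, measurable B & G i = \1_B) ->
    (forall i, measurable_fun setT (G i)) -> (forall i x, 0 <= G i x)%R ->
    (forall i, \int[nu]_x (G i x)%:E = (h i)%:E) ->
    \int[P]_w (\prod_i G i (X i w))%:E = (\prod_i h i)%:E.
  by move=> mF F0 Fe; apply: (main #|I| [set: I]%SET) => //;
    [rewrite cardsT|move=> i; rewrite inE].
elim: n A G h => [|n IH] A G h cA indic mG G0 Gh.
  have A0 : A = finset.set0 by apply/eqP; rewrite -cards_eq0 cA.
  have /choice[B BP] : forall i, exists B, measurable B /\ G i = \1_B.
    by move=> i; have [|B mB ->] := indic i; [rewrite A0 inE|exists B].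
  have mB i : measurable (B i) by case: (BP i).
  under eq_integral => w _.
    rewrite (_ : (\prod_i G i (X i w))%R =
      \1_(\bigcap_(i in [set: I]) (X i @^-1` B i)) w); last first.
      have [wB|wB] := pselect ((\bigcap_(i in [set: I]) (X i @^-1` B i)) w).
        rewrite indicE mem_set// big1// => i _.
        by rewrite (BP i).2 indicE mem_set//; exact: wB.
      rewrite indicE memNset//=.
      have [i Bi] : exists i, ~ B i (X i w).
        by apply/existsNP => Bw; apply: wB => i _; exact: Bw.
      by rewrite (bigD1 i)//= (BP i).2 indicE memNset// mul0r.
    over.
  have mbig : measurable (\bigcap_(i in [set: I]) (X i @^-1` B i)).
    apply: fin_bigcap_measurable; first exact: finite_finset.
    by move=> i _; rewrite -[X in measurable X]setTI; exact: mX.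
  transitivity (P (\bigcap_(i in [set: I]) (X i @^-1` B i))).
    by rewrite integral_indic// setIT.
  rewrite indep// -prodEFin; apply: eq_bigr => i _.
  by rewrite -Gh (BP i).2 integral_indic// setIT.
have /card_gt0P[a aA] : (0 < #|A|)%N by rewrite cA.
rewrite (bigD1 a)//= mulrC EFinM -Gh.
under [LHS]eq_integral do rewrite (bigD1 a)//=.
have h0 i : (0 <= h i)%R.
  by rewrite -lee_fin -Gh; apply: integral_ge0 => x _; rewrite lee_fin.
apply: (@ge0_integral_density _ _ _ _ _ P nu (X a)
  (fun w => \prod_(i | i != a) G i (X i w))%R).
- exact: mX.
- under eq_fun do rewrite -big_filter.
  by apply: measurable_prod => i _; exact: measurableT_comp.
- by move=> w; apply: prodr_ge0.
- by apply: prodr_ge0.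
- move=> B mB.
  pose G' i := if i == a then \1_B else G i.
  pose h' i := if i == a then fine (nu B) else h i.
  transitivity (\int[P]_w (\prod_i G' i (X i w))%:E).
    apply: eq_integral => w _; rewrite [in RHS](bigD1 a)//= {1}/G' eqxx.
    by congr (_ * _)%:E; apply: eq_bigr => i /negbTE ia; rewrite /G' ia.
  rewrite (IH (A :\ a)%SET G' h').
  - rewrite (bigD1 a)//= {1}/h' eqxx mulrC EFinM fineK ?nufin//.
    by congr (_%:E * _); apply: eq_bigr => i /negbTE ia; rewrite /h' ia.
  - by move: cA; rewrite (cardsD1 a) aA add1n => -[].
  - move=> i; rewrite !inE negb_and negbK /G'.
    by case: eqVneq => [_ _|_ /= iA]; [exists B|exact: indic].
  - by move=> i; rewrite /G'; case: ifP.
  - move=> i x; rewrite /G'; case: ifP => // _.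
  - move=> i; rewrite /G' /h'; case: ifP => // _.
    by rewrite integral_indic// setIT fineK ?nufin.
- exact: mG.
- by move=> y.
Qed.

Lemma integral_normal_prob (R : realType) (f : R -> R) :
  measurable_fun setT f -> (forall x, 0 <= f x)%R ->
  \int[normal_prob (0 : R) 1]_x (f x)%:E =
  \int[lebesgue_measure]_x (f x * normal_pdf 0 1 x)%:E.
Proof.
move=> mf f0.
rewrite (@ge0_integral_density _ _ (measurableTypeR R) (measurableTypeR R) R
  lebesgue_measure (normal_prob (0 : R) 1) idfun (normal_pdf 0 1) 1) ?mul1e//.
- exact: measurable_id.
- exact: measurable_normal_pdf.
- by move=> x; exact: normal_pdf_ge0.
- move=> B mB; rewrite mul1e /normal_prob [RHS]integral_mkcond.
  apply: eq_integral => x _; rewrite patchE indicE.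
  by case: ifPn => xB; rewrite ?mul1r ?mul0r.
Qed.

Lemma normal_mgf_sq (R : realType) (s : R) : (0 <= s)%R ->
  \int[normal_prob (0 : R) 1]_x (expR (s / (1 + 2 * s) * x ^+ 2))%:E
  = (Num.sqrt (1 + 2 * s))%:E.
Proof.
move=> s0; set sg := Num.sqrt _.
have s1 : (0 < 1 + 2 * s)%R by lra.
have sg0 : (0 < sg)%R by rewrite sqrtr_gt0.
have sg2 : (sg ^+ 2 = 1 + 2 * s)%R by rewrite sqr_sqrtr// ltW.
have mf : measurable_fun setT (fun x : R => expR (s / (1 + 2 * s) * x ^+ 2)).
  by apply: measurableT_comp => //; apply: measurable_funM.
rewrite integral_normal_prob//.
transitivity (\int[lebesgue_measure]_x (sg%:E * (normal_pdf 0 sg x)%:E)); last first.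
  rewrite ge0_integralZl//= ?integral_normal_pdf ?mule1// ?lee_fin ?ltW//.
    by apply/measurable_EFinP; exact: measurable_normal_pdf.
  by move=> x _; rewrite lee_fin normal_pdf_ge0.
apply: eq_integral => x _; rewrite -EFinM; congr _%:E.
rewrite !normal_pdfE ?gt_eqF//= /normal_peak /normal_fun.
rewrite mulrCA -expRD expr1n mul1r !subr0 [RHS]mulrA.
congr (_ * expR _)%R.
  rewrite -mulrnAr sqrtrM ?sqr_ge0// sqrtr_sqr ger0_norm ?ltW//.
  by rewrite invfM mulrA divff ?gt_eqF// mul1r.
by rewrite sg2; field; rewrite gt_eqF.
Qed.

End independence.

(** * Chernoff and entropy bounds *)

Section analysis.
Variable R : realType.
Implicit Types (s x y beta : R) (n k p r : nat).

Lemma le_sinh y : 0 <= y -> 2 * y <= expR y - expR (- y).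
Proof.
move=> y0; pose f (z : R) := expR z - expR (- z) - 2 * z.
have df (z : R) : is_derive z 1 f (expR z + expR (- z) - 2).
  apply: is_derive_eq => /=.
  by rewrite mulrN1 opprK /GRing.scale/= mulr1.
have cf : {within `[0, y], continuous f}.
  by apply: derivable_within_continuous => z _; apply: ex_derive; exact: df.
have [c _] := MVT_segment y0 (fun z _ => df z) cf.
rewrite /f oppr0 mulr0 !subrr subr0 addr0 => E.
rewrite -subr_ge0 E; apply: mulr_ge0 => //; rewrite expRN.
have e0 := expR_gt0 c; rewrite [X in 0 <= X](_ : _ = (expR c - 1) ^+ 2 / expR c).
  by rewrite divr_ge0// ?sqr_ge0// ltW.
by field; rewrite gt_eqF.
Qed.

Lemma ln_le_half_subV x : 1 <= x -> 2 * ln x <= x - x^-1.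
Proof.
move=> x1; have x0 : 0 < x by rewrite (lt_le_trans ltr01).
by have := le_sinh (ln_ge0 x1); rewrite expRN lnK.
Qed.

Lemma chi2_chernoff (r : nat) s : 0 <= s ->
  expR (- (s / (1 + 2 * s) * (r%:R + 2 * r%:R * s + 2 * r%:R * s ^+ 2))) *
  Num.sqrt (1 + 2 * s) ^+ r <= expR (- (r%:R * s ^+ 2)).
Proof.
move=> s0; have s1 : 1 <= 1 + 2 * s by lra.
have s1' : 0 < 1 + 2 * s by lra.
have sq : Num.sqrt (1 + 2 * s) <= expR ((s + s ^+ 2) / (1 + 2 * s)).
  rewrite -ler_sqr ?nnegrE ?sqrtr_ge0 ?expR_ge0// sqr_sqrtr; last exact: ltW.
  rewrite -expRM_natl -[leLHS]lnK// ler_expR.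
  have -> : 2%:R * ((s + s ^+ 2) / (1 + 2 * s)) =
      ((1 + 2 * s) - (1 + 2 * s)^-1) / 2 by field; rewrite gt_eqF.
  by rewrite ler_pdivlMr// mulrC ln_le_half_subV.
apply: (@le_trans _ _ (expR (- (s / (1 + 2 * s) *
   (r%:R + 2 * r%:R * s + 2 * r%:R * s ^+ 2))) *
   expR ((s + s ^+ 2) / (1 + 2 * s)) ^+ r)).
  by rewrite ler_wpM2l ?expR_ge0// lerXn2r// ?nnegrE ?sqrtr_ge0 ?expR_ge0.
rewrite -expRM_natl -expRD ler_expR le_eqVlt; apply/orP; left; apply/eqP.
by field; rewrite gt_eqF.
Qed.

Lemma sum_exprn_le (z : R) n : 0 <= z -> z < 1 ->
  \sum_(k < n) z ^+ k <= (1 - z)^-1.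
Proof.
move=> z0 z1; rewrite -(ler_pM2l (_ : 0 < 1 - z)) ?subr_gt0//.
rewrite divff ?subr_eq0 ?gt_eqF// -opprB mulNr -subrX1 opprB.
by rewrite gerBl exprn_ge0.
Qed.

Local Notation L p k := (ln (expR 1 * p%:R / k%:R : R)).

Lemma logE p k : (0 < p)%N -> (0 < k)%N -> L p k = 1 + ln p%:R - ln k%:R.
Proof.
move=> p0 k0; rewrite ln_div ?posrE ?mulr_gt0 ?expR_gt0 ?ltr0n//.
by rewrite lnM ?posrE ?expR_gt0 ?ltr0n// expRK.
Qed.

Lemma log_ge1 p k : (0 < k)%N -> (k <= p)%N -> 1 <= L p k.
Proof.
move=> k0 kp; have p0 := leq_trans k0 kp.
by rewrite logE// -addrA lerDl subr_ge0 ler_ln ?posrE ?ltr0n// ler_nat.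
Qed.

Lemma log_le p k l : (0 < k)%N -> (k <= l)%N -> (l <= p)%N -> L p l <= L p k.
Proof.
move=> k0 kl lp; have l0 := leq_trans k0 kl; have p0 := leq_trans l0 lp.
by rewrite !logE// lerB// ler_ln ?posrE ?ltr0n// ler_nat.
Qed.

Lemma bin_le_expR p k : (0 < k)%N -> (k <= p)%N ->
  'C(p, k)%:R <= expR (k%:R * L p k).
Proof.
move=> k0 kp; have p0 := leq_trans k0 kp.
rewrite expRM_natl lnK ?posrE ?divr_gt0 ?mulr_gt0 ?expR_gt0 ?ltr0n//.
have kf : 0 < (k`!)%:R :> R by rewrite ltr0n fact_gt0.
have kk : 0 < k%:R ^+ k :> R by rewrite exprn_gt0 ?ltr0n.
have ek : k%:R ^+ k / k`!%:R <= expR 1 ^+ k :> R.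
  rewrite -expRM_natl mulr1; case: k k0 {kp kf kk} => // k _.
  by have := expR_ge1Dxn k (ler0n R k.+1); lra.
rewrite expr_div_n exprMn ler_pdivlMr//.
have bp : 'C(p, k)%:R * k`!%:R <= p%:R ^+ k :> R.
  rewrite -natrM bin_ffact -natrX ler_nat.
  elim: k {k0 kp kf kk ek} => // k IH.
  by rewrite ffactnSr expnSr leq_mul// leq_subr.
rewrite -(ler_pM2r kf) mulrAC.
apply: le_trans (_ : p%:R ^+ k * k%:R ^+ k <= _).
  by rewrite ler_wpM2r// ltW.
by rewrite mulrAC mulrC ler_wpM2r ?exprn_ge0// -ler_pdivrMr.
Qed.

Lemma sum_log_le p k : (k <= p)%N ->
  \sum_(1 <= i < k.+1) L p i <= k%:R * L p k + k%:R.
Proof.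
elim: k => [|k IH] kp; first by rewrite big_geq// mul0r addr0.
have p0 : (0 < p)%N by exact: leq_ltn_trans kp.
rewrite big_nat_recr//= (le_trans (lerD (IH (ltnW kp)) (lexx _)))//.
case: k {IH} kp => [|k] kp; first by rewrite mul0r mul1r addr0 add0r lerDl.
have k0 : 0 < k.+1%:R :> R by rewrite ltr0n.
have k1 : 0 < k.+2%:R :> R by rewrite ltr0n.
have : ln k.+2%:R - ln k.+1%:R <= k.+1%:R^-1 :> R.
  rewrite -ln_div ?posrE// -natr1 mulrDl divff ?gt_eqF// mul1r le_ln1Dx//.
  by rewrite (@lt_trans _ _ 0)// invr_gt0.
rewrite -(ler_pM2l k0) divff ?gt_eqF// !logE// -[k.+2%:R in X in _ -> X]natr1.
by rewrite -[k.+2]addn1 natrD; nra.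
Qed.

Lemma sqrtM_le (a b : R) : 0 <= a -> 0 <= b -> Num.sqrt (2 * a * b) <= a + b / 2.
Proof.
move=> a0 b0; rewrite -[leRHS]ger0_norm ?addr_ge0 ?divr_ge0// -sqrtr_sqr.
rewrite ler_wsqrtr// -subr_ge0.
by rewrite (_ : _ - _ = (a - b / 2) ^+ 2) ?sqr_ge0//; field.
Qed.

Lemma tk_le_sum p r beta k : 2 < beta -> (0 < k)%N -> (k <= p)%N ->
  tk p r beta k <= 2 * beta * (r%:R + L p k).
Proof.
move=> beta2 k0 kp; rewrite /tk; have L1 := log_ge1 k0 kp.
have b0 : 0 <= beta * L p k. by rewrite mulr_ge0//; lra.
have r0 : 0 <= r%:R :> R by [].
have := sqrtM_le r0 b0; rewrite !mulrA. nra.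
Qed.

Lemma tk_ge p r beta k : 2 < beta -> (0 < k)%N -> (k <= p)%N -> r%:R + 1 <= tk p r beta k.
Proof.
move=> beta2 k0 kp; rewrite /tk; have L1 := log_ge1 k0 kp.
have := sqrtr_ge0 (2 * r%:R * beta * L p k); nra.
Qed.

Lemma tk_anti p r beta k l : 2 < beta -> (0 < k)%N -> (k <= l)%N -> (l <= p)%N ->
  tk p r beta l <= tk p r beta k.
Proof.
move=> beta2 k0 kl lp; rewrite /tk; have Lkl := log_le k0 kl lp.
have b0 : 0 <= beta by lra.
rewrite lerD ?ler_wpM2l// lerD2l ler_wsqrtr//.
by rewrite ler_wpM2l// !mulr_ge0.
Qed.

Lemma natmul_tk_le_sum p r beta k : 2 < beta -> (k <= p)%N ->
  k%:R * tk p r beta k <= \sum_(1 <= i < k.+1) tk p r beta i.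
Proof.
move=> beta2 kp.
have -> : k%:R * tk p r beta k = \sum_(1 <= i < k.+1) tk p r beta k.
  by rewrite sumr_const_nat subSS subn0 mulr_natl.
rewrite big_nat_cond [leRHS]big_nat_cond.
by apply: ler_sum => i /andP[/andP[i0 ik] _]; exact: tk_anti.
Qed.

Lemma sum_tk_mono p r beta k l : 2 < beta -> (k <= l)%N -> (l <= p)%N ->
  \sum_(1 <= i < k.+1) tk p r beta i <= \sum_(1 <= i < l.+1) tk p r beta i.
Proof.
move=> beta2 kl lp; rewrite [leRHS](@big_cat_nat _ _ _ k.+1)//= lerDl big_nat_cond.
apply: sumr_ge0 => i /andP[/andP[ki il] _].
have i0 : (0 < i)%N by exact: leq_ltn_trans ki.
have ip : (i <= p)%N by exact: leq_trans lp.
by apply: le_trans (tk_ge r beta2 i0 ip); rewrite addr_ge0.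
Qed.

Lemma sum_tk_le p r beta k : 2 < beta -> (0 < k)%N -> (k <= p)%N ->
  \sum_(1 <= i < k.+1) tk p r beta i <= 4 * beta * k%:R * (r%:R + L p k).
Proof.
move=> beta2 k0 kp; have L1 := log_ge1 k0 kp.
apply: (@le_trans _ _ (\sum_(1 <= i < k.+1) 2 * beta * (r%:R + L p i))).
  rewrite big_nat_cond [leRHS]big_nat_cond.
  apply: ler_sum => i /andP[/andP[i0 ik] _]; apply: tk_le_sum => //.
  exact: leq_trans kp.
rewrite -mulr_sumr big_split/= sumr_const_nat subSS subn0 -[r%:R *+ k]mulr_natr.
have := sum_log_le kp.
have -> : 4 * beta * k%:R * (r%:R + L p k) =
  2 * beta * (k%:R * (2 * (r%:R + L p k))) by ring.
move=> H; rewrite ler_pM2l; last lra.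
have r0 : 0 <= r%:R :> R by [].
have k1 : 0 <= k%:R :> R by [].
nra.
Qed.

End analysis.

(** * Deterministic loss bound *)

Section selection.
Variable R : realType.
Implicit Types (p r : nat) (beta delta : R).

Definition rows_sq p r (A : 'M[R]_(p, r)) (S : {set 'I_p}) : R :=
  \sum_(i in S) \sum_(j < r) A i j ^+ 2.

Definition restr_rows p r (A : 'M[R]_(p, r)) (S : {set 'I_p}) : 'M[R]_(p, r) :=
  \matrix_(i, j) (if i \in S then A i j else 0).

Lemma rows_sq_ge0 p r (A : 'M[R]_(p, r)) S : 0 <= rows_sq A S.
Proof. by apply: sumr_ge0 => i _; apply: sumr_ge0 => j _; exact: sqr_ge0. Qed.

Lemma eq_rows_sq p r (A B : 'M[R]_(p, r)) (S : {set 'I_p}) :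
  (forall i j, i \in S -> A i j = B i j) -> rows_sq A S = rows_sq B S.
Proof.
by move=> AB; apply: eq_bigr => i iS; apply: eq_bigr => j _; rewrite AB.
Qed.

Lemma rows_sqID p r (A : 'M[R]_(p, r)) (S S' : {set 'I_p}) :
  rows_sq A S = rows_sq A (S :&: S')%SET + rows_sq A (S :\: S')%SET.
Proof. by rewrite /rows_sq (big_setID S'). Qed.

Lemma frob2_rows_sq p r (A : 'M[R]_(p, r)) (S : {set 'I_p}) :
  frob2 A = rows_sq A S + rows_sq A (~: S)%SET.
Proof.
rewrite /frob2 (bigID (mem S))/=; congr (_ + _).
by apply: eq_bigl => i; rewrite inE.
Qed.

Lemma rows_sq_sub p r (A : 'M[R]_(p, r)) (S S' : {set 'I_p}) :
  S \subset S' -> rows_sq A S <= rows_sq A S'.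
Proof.
move=> /finset.setIidPr SS'; rewrite [leRHS](rows_sqID _ _ S) SS' lerDl.
exact: rows_sq_ge0.
Qed.

Lemma frob2_sub_restr_rows p r (A : 'M[R]_(p, r)) (S : {set 'I_p}) :
  frob2 (A - restr_rows A S) = rows_sq A (~: S)%SET.
Proof.
rewrite (frob2_rows_sq _ S) [X in X + _]big1 ?add0r.
  by apply: eq_rows_sq => i j; rewrite !mxE inE => /negbTE ->; rewrite subr0.
by move=> i iS; apply: big1 => j _; rewrite !mxE iS subrr expr0n.
Qed.

Lemma supp_restr_rows p r (A : 'M[R]_(p, r)) (S : {set 'I_p}) :
  supp (restr_rows A S) \subset S.
Proof.
apply/fintype.subsetP => i; rewrite inE; apply: contraR => iS.
by apply/eqP/rowP => j; rewrite !mxE (negbTE iS).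
Qed.

Lemma notin_supp p r (A : 'M[R]_(p, r)) i j : i \notin supp A -> A i j = 0.
Proof. by rewrite inE negbK => /eqP/rowP/(_ j); rewrite !mxE. Qed.

Lemma pen_mono p r beta delta k l : 2 < beta -> (k <= l)%N -> (l <= p)%N ->
  pen p r beta delta k <= pen p r beta delta l.
Proof. by move=> ? ? ?; rewrite ler_wpM2l ?sqr_ge0// sum_tk_mono. Qed.

Lemma penM_restr_rows p r beta delta (A : 'M[R]_(p, r)) (S : {set 'I_p}) :
  2 < beta -> penM beta delta (restr_rows A S) <= pen p r beta delta #|S|.
Proof.
move=> beta2; apply: pen_mono => //; first exact/subset_leq_card/supp_restr_rows.
by rewrite -[leqRHS]card_ord max_card.
Qed.

Section minimizer.
Variables (p r : nat) (beta delta : R) (Y H : 'M[R]_(p, r)).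

Lemma minimizer_supp : 2 < beta -> is_pen_minimizer beta delta Y H ->
  forall i j, i \in supp H -> H i j = Y i j.
Proof.
move=> beta2 /(_ (restr_rows Y (supp H))); rewrite frob2_sub_restr_rows => Hmin.
have := le_trans Hmin (lerD (lexx _) (penM_restr_rows delta Y (supp H) beta2)).
rewrite lerD2r (frob2_rows_sq _ (supp H)).
rewrite (@eq_rows_sq _ _ _ Y (~: supp H)%SET); last first.
  by move=> i j; rewrite inE !mxE => iH; rewrite (notin_supp j iH) subr0.
rewrite gerDr => /(conj (rows_sq_ge0 (Y - H) (supp H))) /andP/le_anti/esym S0 i j iH.
have /eqP := S0; rewrite psumr_eq0; last first.
  by move=> k _; apply: sumr_ge0 => l _; exact: sqr_ge0.
move=> /allP/(_ i (mem_index_enum i)); rewrite iH/= psumr_eq0; last first.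
  by move=> l _; exact: sqr_ge0.
move=> /allP/(_ j (mem_index_enum j))/=.
by rewrite sqrf_eq0 !mxE subr_eq0 => /eqP.
Qed.

Lemma minimizer_rows_sq (S : {set 'I_p}) : 2 < beta ->
  is_pen_minimizer beta delta Y H ->
  rows_sq Y (S :\: supp H)%SET + pen p r beta delta #|supp H| <=
  rows_sq Y (supp H :\: S)%SET + pen p r beta delta #|S|.
Proof.
move=> beta2 Hmin.
have /le_trans/(_ (lerD (lexx _) (penM_restr_rows delta Y S beta2))) :=
  Hmin (restr_rows Y S).
rewrite frob2_sub_restr_rows (frob2_rows_sq _ (supp H)) [X in X + _ + _]big1.
  rewrite add0r (@eq_rows_sq _ _ _ Y (~: supp H)%SET); last first.
    by move=> i j; rewrite inE !mxE => iH; rewrite (notin_supp j iH) subr0.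
  rewrite (rows_sqID _ (~: supp H)%SET S) (rows_sqID _ (~: S)%SET (supp H)).
  have -> : (~: supp H :&: S = S :\: supp H)%SET.
    by apply/setP => i; rewrite !inE.
  have -> : (~: S :&: supp H = supp H :\: S)%SET.
    by apply/setP => i; rewrite !inE.
  have -> : (~: supp H :\: S = ~: S :\: supp H)%SET.
    by apply/setP => i; rewrite !inE andbC.
  by rewrite /penM; lra.
move=> i iH; apply: big1 => j _.
by rewrite !mxE (minimizer_supp beta2 Hmin) ?subrr ?expr0n.
Qed.

End minimizer.

Lemma minimizer_loss p r beta delta (Th E H : 'M[R]_(p, r)) (S : {set 'I_p}) W :
  2 < beta -> 0 < delta -> delta < 1 -> 0 <= W ->
  is_pen_minimizer beta delta (Th + E) H ->
  rows_sq E (supp H) <= \sum_(1 <= i < #|supp H|.+1) tk p r beta i + W ->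
  frob2 (H - Th) <= 6 / delta ^+ 2 *
    (W + rows_sq Th (~: S)%SET + pen p r beta delta #|S| + rows_sq E S).
Proof.
move=> beta2 d0 d1 W0 Hmin.
set T := \sum_(_ <= _ < _) _; set B := rows_sq Th _; set G := rows_sq E S.
set P' := pen _ _ _ _ _; set Z := rows_sq E (supp H) => ZTW.
have T0 : 0 <= T.
  rewrite [leLHS](_ : 0 = \sum_(1 <= i < 1) tk p r beta i); last by rewrite big_geq.
  by apply: sum_tk_mono => //; rewrite -[leqRHS]card_ord max_card.
have lossE : frob2 (H - Th) = Z + rows_sq Th (~: supp H)%SET.
  rewrite (frob2_rows_sq _ (supp H)); congr (_ + _).
    apply: eq_rows_sq => i j iH; rewrite !mxE (minimizer_supp beta2 Hmin)// !mxE.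
    by rewrite addrC addKr.
  apply: eq_bigr => i; rewrite inE => iH; apply: eq_bigr => j _.
  by rewrite !mxE (notin_supp j iH) sub0r sqrrN.
have ThH : rows_sq Th (~: supp H)%SET <= B + rows_sq Th (S :\: supp H)%SET.
  rewrite (rows_sqID _ _ S) addrC; apply: lerD.
    by apply: rows_sq_sub; apply/fintype.subsetP => i; rewrite !inE => /andP[].
  by rewrite finset.setIC -finset.setDE.
have YE : rows_sq (Th + E) (supp H :\: S)%SET <=
    (1 + delta) * Z + (1 + delta^-1) * B.
  apply: (@le_trans _ _ ((1 + delta) * rows_sq E (supp H :\: S)%SET +
      (1 + delta^-1) * rows_sq Th (supp H :\: S)%SET)); last first.
    have di : 0 < delta^-1 by rewrite invr_gt0.
    apply: lerD; (apply: ler_wpM2l; first lra).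
      by apply: rows_sq_sub; exact: subsetDl.
    by apply: rows_sq_sub; apply/fintype.subsetP => i; rewrite !inE => /andP[].
  rewrite /rows_sq !mulr_sumr -big_split/=; apply: ler_sum => i _.
  rewrite !mulr_sumr -big_split/=; apply: ler_sum => j _; rewrite !mxE.
  rewrite -subr_ge0 (_ : _ - _ = (delta * E i j - Th i j) ^+ 2 / delta).
    by rewrite divr_ge0 ?sqr_ge0// ltW.
  by field; rewrite gt_eqF.
have ThYE : rows_sq Th (S :\: supp H)%SET <=
    2 * rows_sq (Th + E) (S :\: supp H)%SET + 2 * G.
  apply: (@le_trans _ _ (2 * rows_sq (Th + E) (S :\: supp H)%SET +
      2 * rows_sq E (S :\: supp H)%SET)); last first.
    by rewrite lerD2l ler_pM2l//; apply: rows_sq_sub; exact: subsetDl.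
  rewrite /rows_sq !mulr_sumr -big_split/=; apply: ler_sum => i _.
  rewrite !mulr_sumr -big_split/=; apply: ler_sum => j _; rewrite !mxE.
  rewrite -subr_ge0 (_ : _ - _ = (Th i j + E i j + E i j) ^+ 2); last by ring.
  exact: sqr_ge0.
have := minimizer_rows_sq S beta2 Hmin; rewrite {1}/pen -/T -/P' lossE.
set N := rows_sq (Th + E) _ in ThYE * => main.
have B0 : 0 <= B by exact: rows_sq_ge0.
have G0 : 0 <= G by exact: rows_sq_ge0.
have N0 : 0 <= N by exact: rows_sq_ge0.
have P0 : 0 <= P'.
  rewrite mulr_ge0 ?sqr_ge0//.
  rewrite [leLHS](_ : 0 = \sum_(1 <= i < 1) tk p r beta i); last by rewrite big_geq.
  by apply: sum_tk_mono => //; rewrite -[leqRHS]card_ord max_card.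
rewrite mulrAC ler_pdivlMr ?exprn_gt0//.
have key : delta * (N + delta * T) <= 2 * delta * W + (delta + 1) * B + delta * P'.
  have : delta * (N + (1 + delta) ^+ 2 * T) <=
      delta * ((1 + delta) * (T + W) + (1 + delta^-1) * B + P').
    rewrite ler_pM2l//; apply: le_trans main _; rewrite lerD2r.
    apply: le_trans YE _; rewrite lerD2r ler_pM2l//; lra.
  have -> : delta * ((1 + delta) * (T + W) + (1 + delta^-1) * B + P') =
      delta * (1 + delta) * (T + W) + (delta + 1) * B + delta * P'.
    by field; rewrite gt_eqF.
  have : 0 <= delta * (1 - delta) * W.
    by rewrite !mulr_ge0 ?subr_ge0// ltW.
  have : 0 <= delta ^+ 3 * T by rewrite mulr_ge0// exprn_ge0// ltW.
  lra.
have d2 : delta ^+ 2 <= 1 by rewrite expr_le1// ltW.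
apply: (@le_trans _ _ ((T + 2 * N) * delta ^+ 2 + (W + B + 2 * G))).
  have : 0 <= W + B + 2 * G by rewrite !addr_ge0// mulr_ge0.
  set U := W + B + 2 * G => U0.
  apply: (@le_trans _ _ ((T + 2 * N + U) * delta ^+ 2)).
    by rewrite ler_wpM2r ?sqr_ge0// /U; lra.
  by rewrite mulrDl lerD2l ler_piMr.
have : (T + 2 * N) * delta ^+ 2 <= 2 * (delta * (N + delta * T)).
  have : 0 <= delta * (1 - delta) * N.
    by rewrite !mulr_ge0 ?subr_ge0// ltW.
  have : 0 <= delta ^+ 2 * T by rewrite mulr_ge0// sqr_ge0.
  lra.
have h1 : delta * W <= W by rewrite ler_piMl// ltW.
have h2 : delta * B <= B by rewrite ler_piMl// ltW.
have h3 : delta * P' <= P' by rewrite ler_piMl// ltW.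
lra.
Qed.

End selection.

(** * Approximation by sparse matrices *)

Section sparse_approximation.
Variable R : realType.
Implicit Types (p r : nat) (q beta : R).

Lemma powR_le_telescope (b : R) n : 0 <= b -> (0 < n)%N ->
  b / n.+1%:R + 1 <= (1 + n%:R^-1) `^ b.
Proof.
move=> b0 n0; have n0' : 0 < n%:R :> R by rewrite ltr0n.
have n1 : 0 < n.+1%:R :> R by rewrite ltr0n.
have y0 : 0 < 1 + n%:R^-1 :> R by rewrite addr_gt0 ?invr_gt0.
rewrite /powR gt_eqF//; apply: le_trans (expR_ge1Dx _).
rewrite addrC lerD2l ler_wpM2l//.
have -> : 1 + n%:R^-1 = (1 - n.+1%:R^-1)^-1 :> R.
  by rewrite -natr1; field; rewrite addrK natr1 !gt_eqF.
have y1 : 0 < 1 - n.+1%:R^-1 :> R.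
  by rewrite subr_gt0 invf_lt1// ltr1n.
by rewrite lnV ?posrE// lerNr le_ln1Dx// -subr_gt0 opprK addrC.
Qed.

Lemma sum_powR_tail (a : R) K n : 1 < a -> (0 < K)%N -> (K <= n)%N ->
  \sum_(K <= j < n) (K%:R / j.+1%:R) `^ a <= K%:R / (a - 1).
Proof.
move=> a1 K0 Kn; have b0 : 0 < a - 1 by rewrite subr_gt0.
rewrite ler_pdivlMr//.
suff : (\sum_(K <= j < n) (K%:R / j.+1%:R) `^ a) * (a - 1) +
    K%:R * (K%:R / n%:R) `^ (a - 1) <= K%:R.
  by apply: le_trans; rewrite lerDl mulr_ge0// powR_ge0.
have K0' : 0 < K%:R :> R by rewrite ltr0n.
elim: n Kn => [|n IH]; first by rewrite leqn0 => /eqP KE; move: K0; rewrite KE.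
rewrite leq_eqVlt => /predU1P[<-|]; last rewrite ltnS => Kn.
  by rewrite big_geq// mul0r add0r divff ?gt_eqF// powR1 mulr1.
apply: le_trans (IH Kn); rewrite big_nat_recr//= mulrDl -addrA lerD2l.
have n0 := leq_trans K0 Kn; have n0' : 0 < n%:R :> R by rewrite ltr0n.
have n1 : 0 < n.+1%:R :> R by rewrite ltr0n.
set y := K%:R / n.+1%:R; have y0 : 0 < y by rewrite divr_gt0.
have -> : K%:R / n%:R = y * (1 + n%:R^-1).
  by rewrite /y -natr1; field; rewrite natr1 !gt_eqF.
have x0 : 0 < 1 + n%:R^-1 :> R by rewrite addr_gt0 ?invr_gt0.
rewrite (powRM _ (ltW y0) (ltW x0)) -(mulr_powRB1 (ltW y0) (lt_trans ltr01 a1)).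
have := powR_ge0 y (a - 1); move: (y `^ (a - 1)) => z z0.
have -> : y * z * (a - 1) + K%:R * z = K%:R * (z * ((a - 1) / n.+1%:R + 1)).
  by rewrite /y; ring.
by rewrite !ler_wpM2l ?(ltW K0')// powR_le_telescope// ltW.
Qed.

Lemma kprime_gt0 q s' beta p r : (0 < p)%N -> (0 < kprime q s' beta p r)%N.
Proof.
move=> p0; rewrite /kprime; set l := (X in head _ X).
have : {subset l <= iota 1 p} by move=> x; rewrite mem_filter => /andP[].
case: l => //= k l /(_ k); rewrite mem_head mem_iota => /(_ isT).
by case/andP.
Qed.

Lemma kprime_le q s' beta p r : (kprime q s' beta p r <= p)%N.
Proof.
rewrite /kprime; set l := (X in head _ X).
have : {subset l <= iota 1 p} by move=> x; rewrite mem_filter => /andP[].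
case: l => //= k l /(_ k); rewrite mem_head mem_iota => /(_ isT).
by case/andP; rewrite add1n ltnS.
Qed.

Lemma kprimeP q s' beta p r (k := kprime q s' beta p r) :
  k = p \/ s' <= tk p r beta k `^ (q / 2) * k%:R.
Proof.
rewrite /k /kprime; set P := (fun k : nat => s' <= _).
have : all P (seq.filter P (iota 1 p)) by exact: filter_all.
by case: (seq.filter _ _) => [|x l] /=; [left|move=> /andP[Px _]; right].
Qed.

Lemma sum_sorted_rownorms p r (A : 'M[R]_(p, r)) (g : R -> R) :
  \sum_i g (rownorm A i) = \sum_(j < p) g (nth 0 (sorted_rownorms A) j).
Proof.
transitivity (\sum_(x <- [seq rownorm A i | i <- enum 'I_p]) g x).
  by rewrite big_map big_enum.
rewrite (perm_big (sorted_rownorms A)) /=; last first.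
  by rewrite perm_sym /sorted_rownorms perm_sort.
rewrite (big_nth 0) big_mkord /sorted_rownorms size_sort size_map.
by rewrite size_enum_ord.
Qed.

Lemma rownorm_sq p r (A : 'M[R]_(p, r)) i :
  rownorm A i ^+ 2 = \sum_(j < r) A i j ^+ 2.
Proof. by rewrite sqr_sqrtr// sumr_ge0// => j _; exact: sqr_ge0. Qed.

Lemma sorted_rownorm_ge0 p r (A : 'M[R]_(p, r)) j :
  0 <= nth 0 (sorted_rownorms A) j.
Proof.
have [js|js] := ltnP j (size (sorted_rownorms A)); last by rewrite nth_default.
have := mem_nth 0 js; rewrite mem_sort => /mapP[i _ ->].
exact: sqrtr_ge0.
Qed.

Lemma weak_lq_sorted_le q s' p r (A : 'M[R]_(p, r)) j : q != 0 ->
  Fq q s' A -> (j < p)%N ->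
  j.+1%:R * nth 0 (sorted_rownorms A) j `^ q <= s'.
Proof.
move=> q0; rewrite /Fq/= /weak_lq (negbTE q0) => + jp.
by apply: le_trans; rewrite (le_bigmax _ _ (Ordinal jp)).
Qed.

Lemma sparse_approx q s' beta p r (Th : 'M[R]_(p, r))
    (k := kprime q s' beta p r) :
  0 <= q -> q < 2 -> 2 < beta -> (0 < p)%N -> Fq q s' Th ->
  exists2 S : {set 'I_p}, (#|S| <= k)%N &
    rows_sq Th (~: S)%SET <= 2 / (2 - q) * (k%:R * tk p r beta k).
Proof.
move=> q0 q2 beta2 p0 FTh.
have k0 : (0 < k)%N by exact: kprime_gt0.
have kp : (k <= p)%N by exact: kprime_le.
have t1 := tk_ge r beta2 k0 kp; set t := tk _ _ _ _ in t1 *.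
have t0 : 0 < t by rewrite (lt_le_trans _ t1)// ltr_wpDl.
have bnd0 : 0 <= 2 / (2 - q) * (k%:R * t).
  by rewrite !mulr_ge0 ?invr_ge0 ?subr_ge0// ltW.
have [kE|sk] := kprimeP q s' beta p r.
  exists [set: 'I_p]%SET; first by rewrite cardsT card_ord /k kE.
  by rewrite /rows_sq finset.setCT big_set0.
have [qE|qN0] := eqVneq q 0.
  exists (supp Th).
    move: FTh; rewrite /Fq/= /weak_lq qE eqxx => /le_trans/(_ sk).
    have -> : q / 2 = 0 by rewrite qE mul0r.
    by rewrite powRr0 mul1r ler_nat.
  rewrite [X in X <= _](_ : _ = 0)// /rows_sq big1// => i.
  by rewrite inE => iS; rewrite big1// => j _; rewrite (notin_supp j iS) expr0n.
have qgt0 : 0 < q by rewrite lt_neqAle eq_sym qN0.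
have a1 : 1 < 2 / q by rewrite ltr_pdivlMr// mul1r.
pose s j := nth 0 (sorted_rownorms Th) j.
have s0 j : 0 <= s j by exact: sorted_rownorm_ge0.
have s_le j : (j < p)%N -> s j ^+ 2 <= t * (k%:R / j.+1%:R) `^ (2 / q).
  move=> jp; have /le_trans/(_ sk) := weak_lq_sorted_le qN0 FTh jp.
  rewrite -/t -/k mulrC -ler_pdivlMr ?ltr0n// -mulrA => sj.
  have : (s j `^ q) `^ (2 / q) <= (t `^ (q / 2) * (k%:R / j.+1%:R)) `^ (2 / q).
    apply: ge0_ler_powR => //; first by rewrite divr_ge0.
      by rewrite nnegrE powR_ge0.
    by rewrite nnegrE mulr_ge0 ?powR_ge0// divr_ge0.
  rewrite powRM ?powR_ge0 ?divr_ge0// -!powRrM.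
  have -> : q * (2 / q) = 2%:R by field.
  have -> : q / 2 * (2 / q) = 1 by field.
  by rewrite (powRr1 (ltW t0)) powR_mulrn.
have pow1 j : (k <= j)%N -> (k%:R / j.+1%:R) `^ (2 / q) <= 1.
  move=> kj; have E1 : 1 `^ (2 / q) = 1 :> R by rewrite powR1.
  rewrite -[leRHS]E1.
  apply: ge0_ler_powR; rewrite ?nnegrE ?divr_ge0//.
  by rewrite ler_pdivrMr ?ltr0n// mul1r ler_nat leqW.
pose S := [set i | t < rownorm Th i ^+ 2]%SET.
exists S.
  rewrite -(ler_nat R) -sum1_card natr_sum big_mkcond/=.
  under eq_bigr do rewrite inE.
  rewrite (sum_sorted_rownorms Th (fun x => if t < x ^+ 2 then 1 else 0)).
  rewrite -(big_mkord xpredT (fun j => if t < s j ^+ 2 then 1 else 0)).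
  rewrite (@big_cat_nat _ _ _ k)//= [X in _ + X]big_nat_cond.
  rewrite [X in _ + X]big1 ?addr0; last first.
    move=> j /andP[/andP[kj jp] _]; rewrite ifF//; apply/negbTE; rewrite -leNgt.
    by apply: le_trans (s_le _ jp) _; rewrite ler_piMr ?(ltW t0) ?pow1.
  apply: le_trans (_ : \sum_(0 <= j < k) 1 <= _).
    by apply: ler_sum => j _; case: ifP.
  by rewrite sumr_const_nat subn0.
have -> : rows_sq Th (~: S)%SET =
    \sum_i (if t < rownorm Th i ^+ 2 then 0 else rownorm Th i ^+ 2).
  rewrite /rows_sq big_mkcond/=; apply: eq_bigr => i _; rewrite !inE.
  by case: ifP; rewrite rownorm_sq; case: ifP.
rewrite (sum_sorted_rownorms Th (fun x => if t < x ^+ 2 then 0 else x ^+ 2)).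
rewrite -(big_mkord xpredT (fun j => if t < s j ^+ 2 then 0 else s j ^+ 2)).
rewrite (@big_cat_nat _ _ _ k)//=.
apply: (@le_trans _ _ (\sum_(0 <= j < k) t +
    \sum_(k <= j < p) t * (k%:R / j.+1%:R) `^ (2 / q))).
  apply: lerD.
    by apply: ler_sum => j _; case: ltP => // _; exact: ltW.
  rewrite big_nat_cond [leRHS]big_nat_cond.
  apply: ler_sum => j /andP[/andP[kj jp] _]; case: ifP => _; last exact: s_le.
  by rewrite mulr_ge0 ?powR_ge0// ltW.
rewrite sumr_const_nat subn0 -mulr_sumr -[t *+ k]mulr_natl.
apply: (@le_trans _ _ (k%:R * t + t * (k%:R / (2 / q - 1)))).
  by rewrite lerD2l ler_wpM2l ?(ltW t0)// sum_powR_tail.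
rewrite le_eqVlt; apply/orP; left; apply/eqP; field.
by rewrite qN0/= subr_eq0 gt_eqF.
Qed.

End sparse_approximation.

(** * Gaussian noise *)

Section gaussian_noise.
Variable R : realType.
Implicit Types (p r : nat) (beta : R).

Definition noise d (T : measurableType d) p r (E : 'I_p -> 'I_r -> T -> R)
  (w : T) : 'M[R]_(p, r) := \matrix_(i, j) E i j w.

Lemma measurable_rows_sq d (T : measurableType d) p r
    (E : 'I_p -> 'I_r -> T -> R) (S : {set 'I_p}) :
  (forall i j, measurable_fun setT (E i j)) ->
  measurable_fun setT (fun w => rows_sq (noise E w) S).
Proof.
move=> mE; rewrite /rows_sq; under eq_fun do rewrite -big_filter.
apply: measurable_sum => i; apply: measurable_sum => j.
by under eq_fun do rewrite mxE; exact: measurable_funX.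
Qed.

Local Open Scope ereal_scope.

Lemma integral_gaussian_entry d (T : measurableType d) (P : probability T R)
    p r (E : 'I_p -> 'I_r -> T -> R) i j (f : R -> R) :
  iid_std_gaussian P E -> measurable_fun setT f -> (forall x, 0 <= f x)%R ->
  \int[P]_w (f (E i j w))%:E = \int[normal_prob (0 : R) 1]_x (f x)%:E.
Proof.
move=> [mE [lawE _]] mf f0.
have := @ge0_integral_density _ _ _ _ R P (normal_prob (0 : R) 1) (E i j)
  (cst 1%R) 1%R f (mE i j) (measurable_cst _) (fun=> ler01) ler01 _ mf f0.
rewrite mul1e => <-; first by apply: eq_integral => w _; rewrite mulr1.
move=> B mB; rewrite mul1e; transitivity (P (E i j @^-1` B)); last exact: lawE.
under eq_integral do rewrite mulr1.
rewrite -[LHS]/(\int[P]_w (\1_(E i j @^-1` B) w)%:E) integral_indic ?setIT//.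
by rewrite -[X in measurable X]setTI; exact: mE.
Qed.

Lemma mgf_rows_sq d (T : measurableType d) (P : probability T R) p r
    (E : 'I_p -> 'I_r -> T -> R) (S : {set 'I_p}) (s : R) :
  iid_std_gaussian P E -> (0 <= s)%R ->
  \int[P]_w (expR (s / (1 + 2 * s) * rows_sq (noise E w) S))%:E =
  (Num.sqrt (1 + 2 * s) ^+ (#|S| * r))%:E.
Proof.
move=> [mE [lawE indepE]] s0; set l := (s / _)%R.
pose F (ij : 'I_p * 'I_r) (x : R) : R := if ij.1 \in S then expR (l * x ^+ 2) else 1%R.
pose e (ij : 'I_p * 'I_r) : R := if ij.1 \in S then Num.sqrt (1 + 2 * s) else 1%R.
have := @integral_prod_indep _ _ T (measurableTypeR R) R P (normal_prob (0 : R) 1)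
  ('I_p * 'I_r)%type (fun ij => E ij.1 ij.2) F e.
have -> : (\prod_i e i = Num.sqrt (1 + 2 * s) ^+ (#|S| * r))%R.
  rewrite -(pair_bigA _ (fun i j => e (i, j)))/= /e/=.
  rewrite (bigID (mem S))/= [X in (_ * X)%R]big1 ?mulr1.
    under eq_bigr => i iS do rewrite iS prodr_const card_ord.
    by rewrite prodr_const -exprM mulnC.
  by move=> i /negbTE iS; rewrite big1// => j _; rewrite iS.
move=> <-.
- apply: eq_integral => w _; congr EFin.
  rewrite -(pair_bigA _ (fun i j => F (i, j) (E i j w)))/= /F/=.
  rewrite [RHS](bigID (mem S))/= [X in _ = (_ * X)%R]big1 ?mulr1; last first.
    by move=> i /negbTE iS; rewrite big1// => j _; rewrite iS.
  rewrite /rows_sq mulr_sumr expR_sum; apply: eq_bigr => i iS.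
  rewrite mulr_sumr expR_sum; apply: eq_bigr => j _.
  by rewrite iS mxE.
- by move=> ij; exact: mE.
- move=> B mB; transitivity (P (\bigcap_(ij in [set: 'I_p * 'I_r])
      (E ij.1 ij.2 @^-1` B (ij.1, ij.2)))).
    by congr (P _); apply: eq_bigcapr => -[].
  rewrite (indepE (fun i j => B (i, j))); last by move=> i j; exact: mB.
  rewrite (pair_bigA _ (fun i j => P (E i j @^-1` B (i, j))))/=.
  by apply: eq_bigr => -[i j] _ /=; apply: lawE; exact: mB.
- by move=> B mB; exact: fin_num_measure.
- move=> ij; rewrite /F; case: (ij.1 \in S); last exact: measurable_cst.
  by apply: measurableT_comp => //; apply: measurable_funM.
- by move=> ij x; rewrite /F; case: (ij.1 \in S); rewrite ?expR_ge0.
- move=> ij; rewrite /F /e; case: (ij.1 \in S); first exact: normal_mgf_sq.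
  rewrite integral_cst// mul1e; exact: (probability_setT (normal_prob (0 : R) 1)).
Qed.

Lemma integral_rows_sq_le d (T : measurableType d) (P : probability T R) p r
    (E : 'I_p -> 'I_r -> T -> R) (S : {set 'I_p}) :
  iid_std_gaussian P E ->
  \int[P]_w (rows_sq (noise E w) S)%:E <= (8 * (#|S|%:R * r%:R))%:E.
Proof.
move=> iidE; have mE := iidE.1.
have sq_le (i : 'I_p) (j : 'I_r) : \int[P]_w (E i j w ^+ 2)%:E <= 8%:E.
  rewrite (integral_gaussian_entry i j (f := fun x => x ^+ 2)%R)//; last first.
    by move=> x; exact: sqr_ge0.
  pose l : R := (2^-1 / (1 + 2 * 2^-1))%R.
  have lE : l = 4^-1%R by rewrite /l; field.
  apply: (@le_trans _ _ (\int[normal_prob (0 : R) 1]_x (4%:E * (expR (l * x ^+ 2))%:E))).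
    apply: ge0_le_integral => //.
    - by move=> x _; rewrite lee_fin sqr_ge0.
    - by apply/measurable_EFinP; exact: measurable_funX.
    - apply/measurable_EFinP; apply: measurable_funM => //.
      by apply: measurableT_comp => //; apply: measurable_funM.
    - move=> x _; rewrite -EFinM lee_fin lE.
      by have := expR_ge1Dx (4^-1 * x ^+ 2); lra.
  rewrite ge0_integralZl//; last first.
    apply/measurable_EFinP; apply: measurableT_comp => //.
    exact: measurable_funM.
  rewrite normal_mgf_sq// -EFinM lee_fin.
  have : (Num.sqrt (1 + 2 * 2^-1) <= 2 :> R)%R.
    by rewrite -[leRHS]ger0_norm// -sqrtr_sqr ler_wsqrtr//; lra.
  lra.
rewrite /rows_sq; under eq_integral do rewrite -big_filter -sumEFin.
rewrite ge0_integral_sum//; last 2 first.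
- move=> i; apply/measurable_EFinP; apply: measurable_sum => j.
  by under eq_fun do rewrite mxE; exact: measurable_funX.
- by move=> i w _; rewrite lee_fin sumr_ge0// => j _; exact: sqr_ge0.
apply: (@le_trans _ _ (\sum_(i in S) (8 * r%:R)%:E)); last first.
  by rewrite sumEFin sumr_const lee_fin -mulr_natl; lra.
rewrite big_filter; apply: lee_sum => i _; under eq_integral do rewrite -sumEFin.
rewrite ge0_integral_sum//; last 2 first.
- move=> j; apply/measurable_EFinP.
  by under eq_fun do rewrite mxE; exact: measurable_funX.
- by move=> j w _; rewrite lee_fin sqr_ge0.
apply: (@le_trans _ _ (\sum_(j < r) 8%:E)).
  by apply: lee_sum => j _; under eq_integral do rewrite mxE; exact: sq_le.
by rewrite sumEFin sumr_const card_ord lee_fin mulr_natr.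
Qed.

End gaussian_noise.

Section excess.
Variable R : realType.
Implicit Types (p r k : nat) (beta : R).

(* [rate] is the optimal Chernoff parameter [s / (1 + 2 s)] at the level
   [r s^2 = beta L_k / 2], for which [t_k = r + 2 r s + 2 r s^2]. *)
Definition tilt p r beta k : R :=
  Num.sqrt (beta * ln (expR 1 * p%:R / k%:R) / (2 * r%:R)).

Definition rate p r beta k : R := tilt p r beta k / (1 + 2 * tilt p r beta k).

(* An upper bound for [|A_S|^2 - |S| t_|S|], because [x <= exp (l x) / l]; it
   vanishes at the empty set, where [rate] is [0] and [0^-1 = 0]. *)
Definition excess p r beta (A : 'M[R]_(p, r)) (S : {set 'I_p}) : R :=
  (rate p r beta #|S|)^-1 *
  expR (rate p r beta #|S| * (rows_sq A S - #|S|%:R * tk p r beta #|S|)).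

Lemma tilt_sq p r beta k : 2 < beta -> (0 < r)%N -> (0 < k)%N -> (k <= p)%N ->
  r%:R * tilt p r beta k ^+ 2 = beta * ln (expR 1 * p%:R / k%:R) / 2.
Proof.
move=> beta2 r0 k0 kp; have L1 := log_ge1 R k0 kp.
have r0' : 0 < r%:R :> R by rewrite ltr0n.
rewrite sqr_sqrtr; first by field; rewrite gt_eqF.
by rewrite divr_ge0 ?mulr_ge0//; lra.
Qed.

Lemma tilt_gt0 p r beta k : 2 < beta -> (0 < r)%N -> (0 < k)%N -> (k <= p)%N ->
  0 < tilt p r beta k.
Proof.
move=> beta2 r0 k0 kp; have L1 := log_ge1 R k0 kp.
have r0' : 0 < r%:R :> R by rewrite ltr0n.
by rewrite sqrtr_gt0 divr_gt0 ?mulr_gt0//; lra.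
Qed.

Lemma tkE p r beta k (s := tilt p r beta k) :
  2 < beta -> (0 < r)%N -> (0 < k)%N -> (k <= p)%N ->
  tk p r beta k = r%:R + 2 * r%:R * s + 2 * r%:R * s ^+ 2.
Proof.
move=> beta2 r0 k0 kp; have s0 := ltW (tilt_gt0 beta2 r0 k0 kp).
have E := tilt_sq beta2 r0 k0 kp.
have bE : beta * ln (expR 1 * p%:R / k%:R) = 2 * r%:R * s ^+ 2.
  by rewrite -[2 * r%:R * _]mulrA /s E; field.
rewrite /tk -[2 * _ * _ * _]mulrA bE; congr (_ + _ + _).
rewrite (_ : 2 * r%:R * _ = (2 * r%:R * s) ^+ 2); last by ring.
by rewrite sqrtr_sqr ger0_norm// !mulr_ge0.
Qed.

Lemma rate_inv_le p r beta k :
  2 < beta -> (0 < r)%N -> (0 < k)%N -> (k <= p)%N ->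
  0 < rate p r beta k /\ (rate p r beta k)^-1 <= 3 * r%:R.
Proof.
move=> beta2 r0 k0 kp; have s0 := tilt_gt0 beta2 r0 k0 kp.
have E := tilt_sq beta2 r0 k0 kp; have L1 := log_ge1 R k0 kp.
have r1 : 1 <= r%:R :> R by rewrite ler1n.
rewrite /rate; move: (tilt _ _ _ _) s0 E => s s0 E.
have s1 : 0 < 1 + 2 * s by lra.
split; first by rewrite divr_gt0.
have rs : 1 <= r%:R * s.
  rewrite -(@ler_sqr _ 1) ?nnegrE ?mulr_ge0 ?(ltW s0)// expr1n.
  rewrite (_ : _ ^+ 2 = r%:R * (r%:R * s ^+ 2)); last by ring.
  by rewrite mulr_ege1// E; nra.
by rewrite invf_div ler_pdivrMr//; nra.
Qed.

Lemma excess_ge0 p r beta (A : 'M[R]_(p, r)) (S : {set 'I_p}) :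
  0 <= excess beta A S.
Proof.
have s0 : 0 <= tilt p r beta #|S| by exact: sqrtr_ge0.
by rewrite mulr_ge0 ?expR_ge0// invr_ge0 divr_ge0// addr_ge0// mulr_ge0.
Qed.

Lemma rows_sq_le_excess p r beta (A : 'M[R]_(p, r)) (S : {set 'I_p}) :
  2 < beta -> (0 < r)%N ->
  rows_sq A S <= \sum_(1 <= i < #|S|.+1) tk p r beta i +
    \sum_(S' : {set 'I_p} | (0 < #|S'|)%N) excess beta A S'.
Proof.
move=> beta2 r0; have Sp : (#|S| <= p)%N by rewrite -[leqRHS]card_ord max_card.
have [S0|S0] := posnP #|S|.
  rewrite S0 big_geq// add0r (cards0_eq S0) /rows_sq big_set0 sumr_ge0// => S' S'0.
  exact: excess_ge0.
have [l0 _] := rate_inv_le beta2 r0 S0 Sp.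
have xle : rows_sq A S - #|S|%:R * tk p r beta #|S| <= excess beta A S.
  rewrite /excess ler_pdivlMl//; apply: le_trans (expR_ge1Dx _).
  by rewrite lerDr.
rewrite (bigD1 S)//= addrA ler_wpDr//.
  by apply: sumr_ge0 => S' /andP[S'0 _]; exact: excess_ge0.
by have := natmul_tk_le_sum r beta2 Sp; lra.
Qed.

Lemma integral_excess_le d (T : measurableType d) (P : probability T R)
    p r beta (E : 'I_p -> 'I_r -> T -> R) (S : {set 'I_p}) :
  2 < beta -> (0 < r)%N -> (0 < #|S|)%N -> iid_std_gaussian P E ->
  (\int[P]_w (excess beta (noise E w) S)%:E <=
   (3 * r%:R * expR (- (#|S|%:R *
     (beta * ln (expR 1 * p%:R / #|S|%:R) / 2))))%:E)%E.
Proof.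
move=> beta2 r0 k0 iidE.
have kp : (#|S| <= p)%N by rewrite -[leqRHS]card_ord max_card.
have [l0 l3] := rate_inv_le beta2 r0 k0 kp.
have s0 := ltW (tilt_gt0 beta2 r0 k0 kp).
set k := #|S| in k0 kp l0 l3 s0 *.
have c0 : 0 <= (rate p r beta k)^-1 *
    expR (- (rate p r beta k * (k%:R * tk p r beta k))).
  by rewrite mulr_ge0 ?invr_ge0 ?expR_ge0// ltW.
have eE w : excess beta (noise E w) S = (rate p r beta k)^-1 *
    expR (- (rate p r beta k * (k%:R * tk p r beta k))) *
    expR (rate p r beta k * rows_sq (noise E w) S).
  by rewrite /excess -/k -mulrA -expRD; congr (_ * expR _); ring.
under eq_integral do rewrite eE EFinM.
rewrite ge0_integralZl//; last first.
  apply/measurable_EFinP; apply: measurableT_comp => //.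
  by apply: measurable_funM => //; apply: measurable_rows_sq; exact: iidE.1.
rewrite mgf_rows_sq// -EFinM lee_fin -[leLHS]mulrA mulnC exprM -/k.
have expE (x : R) : expR (- (k%:R * x)) = expR (- x) ^+ k.
  by rewrite -mulrN expRM_natl.
rewrite (mulrCA (rate _ _ _ _)) !expE -exprMn.
apply: ler_pM => //; first by rewrite invr_ge0 ltW.
rewrite lerXn2r ?nnegrE ?mulr_ge0 ?expR_ge0 ?exprn_ge0//.
by rewrite -(tilt_sq beta2 r0 k0 kp) tkE// chi2_chernoff.
Qed.

Lemma sum_card_bin (p : nat) (h : nat -> R) :
  \sum_(S : {set 'I_p} | (0 < #|S|)%N) h #|S| =
  \sum_(k < p.+1 | (0 < k)%N) 'C(p, k)%:R * h k.
Proof.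
have inE' (S : {set 'I_p}) : (inord #|S| : 'I_p.+1) = #|S| :> nat.
  by rewrite inordK// ltnS -[leqRHS]card_ord max_card.
rewrite (partition_big (fun S : {set 'I_p} => inord #|S| : 'I_p.+1)
  (fun k : 'I_p.+1 => (0 < k)%N))/=; last by move=> S; rewrite inE'.
apply: eq_bigr => k k0; rewrite (eq_bigr (fun=> h k)); last first.
  by move=> S /andP[_ /eqP <-]; rewrite inE'.
rewrite (eq_bigl (mem [set S : {set 'I_p} | #|S| == k]%SET)).
  by rewrite sumr_const card_draws card_ord mulr_natl.
move=> S; rewrite /= inE -val_eqE/= inE'.
by case: eqVneq => [->|_]; rewrite ?k0 ?andbF.
Qed.

Lemma sum_excess_const_le p beta :
  2 < beta ->
  \sum_(S : {set 'I_p} | (0 < #|S|)%N) expR (- (#|S|%:R *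
     (beta * ln (expR 1 * p%:R / #|S|%:R) / 2))) <=
  (1 - expR (- (beta / 2 - 1)))^-1.
Proof.
move=> beta2; set z := expR (- (beta / 2 - 1)).
rewrite (sum_card_bin p (fun k => expR (- (k%:R *
     (beta * ln (expR 1 * p%:R / k%:R) / 2))))).
have z0 : 0 <= z by exact: expR_ge0.
have z1 : z < 1 by rewrite /z expR_lt1; lra.
apply: le_trans (sum_exprn_le p.+1 z0 z1).
rewrite big_mkcond/=; apply: ler_sum => k _; case: ifPn => k0; last first.
  exact: exprn_ge0.
have kp : (k <= p)%N by rewrite -ltnS.
apply: (@le_trans _ _ (expR (k%:R * ln (expR 1 * p%:R / k%:R)) *
    expR (- (k%:R * (beta * ln (expR 1 * p%:R / k%:R) / 2))))).
  by rewrite ler_wpM2r ?expR_ge0// bin_le_expR.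
rewrite -expRD -expRM_natl ler_expR -mulrN -mulrDr ler_wpM2l//.
by have := log_ge1 R k0 kp; nra.
Qed.

Lemma integral_sum_excess_le d (T : measurableType d) (P : probability T R)
    p r beta (E : 'I_p -> 'I_r -> T -> R) :
  2 < beta -> (0 < r)%N -> iid_std_gaussian P E ->
  (\int[P]_w (\sum_(S : {set 'I_p} | (0 < #|S|)%N) excess beta (noise E w) S)%:E
   <= (3 * r%:R * (1 - expR (- (beta / 2 - 1)))^-1)%:E)%E.
Proof.
move=> beta2 r0 iidE.
under eq_integral do rewrite -big_filter -sumEFin.
rewrite ge0_integral_sum//; last 2 first.
- move=> S; apply/measurable_EFinP; apply: measurable_funM => //.
  apply: measurableT_comp => //; apply: measurable_funM => //.
  by apply: measurable_funB => //; apply: measurable_rows_sq; exact: iidE.1.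
- by move=> S w _; rewrite lee_fin excess_ge0.
rewrite big_filter.
apply: le_trans (_ : (\sum_(S : {set 'I_p} | (0 < #|S|)%N) (3 * r%:R * expR (- (#|S|%:R *
     (beta * ln (expR 1 * p%:R / #|S|%:R) / 2))))%:E <= _)%E).
  by apply: lee_sum => S S0; exact: integral_excess_le.
rewrite sumEFin lee_fin -mulr_sumr ler_wpM2l ?mulr_ge0//.
exact: sum_excess_const_le.
Qed.




End excess.

Theorem theorem6 (R : realType) (q beta delta : R) :
  0 <= q -> q < 2 -> 2 < beta -> 0 < delta -> delta < 1 ->
  exists C : R, 0 < C /\
  forall (p r : nat) (s' : R), (0 < p)%N -> (0 < r)%N -> 0 < s' ->
  forall (d : measure_display) (T : measurableType d) (P : probability T R)
         (E : 'I_p -> 'I_r -> T -> R),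
  iid_std_gaussian P E ->
  forall Thhat : 'M[R]_(p, r) -> 'M[R]_(p, r),
  (forall Y, is_pen_minimizer beta delta Y (Thhat Y)) ->
  forall Th : 'M[R]_(p, r), Fq q s' Th ->
  measurable_fun setT
    (fun w => frob2 (Thhat (Th + \matrix_(i, j) E i j w) - Th)) ->
  (\int[P]_w (frob2 (Thhat (Th + \matrix_(i, j) E i j w) - Th))%:E
    <= (C * (kprime q s' beta p r)%:R
         * (r%:R + ln (expR 1 * p%:R / (kprime q s' beta p r)%:R)))%:E)%E.
Proof.
move=> q0 q2 beta2 d0 d1.
set K := (1 - expR (- (beta / 2 - 1)))^-1.
have K0 : 0 < K by rewrite invr_gt0 subr_gt0 expR_lt1; lra.
have : 0 < 6 / delta ^+ 2 by rewrite divr_gt0// exprn_gt0.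
set D := 6 / _ => D0.
have : 0 < 2 / (2 - q) by rewrite divr_gt0// subr_gt0.
set c := 2 / (2 - q) => c0; pose C := 3 * K + c * (2 * beta) + 16 * beta + 8.
have bt0 : 0 < beta by lra.
exists (D * C); split; first by rewrite mulr_gt0// /C !addr_gt0//;
  apply: mulr_gt0 => //; apply: mulr_gt0.
move=> p r s' p0 r0 s'0 d T P E iidE Thhat Hmin Th FTh mloss.
have [S Sk tail] := sparse_approx q0 q2 beta2 p0 FTh.
set k := kprime q s' beta p r in Sk tail *.
have k0 : (0 < k)%N by exact: kprime_gt0.
have kp : (k <= p)%N by exact: kprime_le.
have L1 := log_ge1 R k0 kp; set L := ln _ in L1 *.
set B := rows_sq Th _ in tail.
set Q : R := k%:R * (r%:R + L).
have k1 : 1 <= k%:R :> R by rewrite ler1n.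
have r1 : 1 <= r%:R :> R by rewrite ler1n.
have rQ : r%:R <= Q by rewrite /Q; nra.
have krQ : k%:R * r%:R <= Q by rewrite /Q; nra.
have tkQ : k%:R * tk p r beta k <= 2 * beta * Q.
  by rewrite /Q mulrCA ler_wpM2l// tk_le_sum.
have penQ : pen p r beta delta #|S| <= 16 * beta * Q.
  apply: le_trans (pen_mono r delta beta2 Sk kp) _; rewrite /pen.
  have d4 : (1 + delta) ^+ 2 <= 4 by nra.
  apply: (@le_trans _ _ (4 * (4 * beta * Q))); last lra.
  apply: ler_pM => //; rewrite ?sqr_ge0//; last first.
    by rewrite /Q mulrA; exact: sum_tk_le.
  by have := sum_tk_mono r beta2 (leq0n k) kp; rewrite big_geq.
have iS : (#|S|%:R <= k%:R :> R) by rewrite ler_nat.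
set pS := pen p r beta delta #|S| in penQ.
pose W w : R := \sum_(S' : {set 'I_p} | (0 < #|S'|)%N) excess beta (noise E w) S'.
pose G w : R := rows_sq (noise E w) S.
have W0 w : 0 <= W w by apply: sumr_ge0 => S' _; exact: excess_ge0.
have G0 w : 0 <= G w by exact: rows_sq_ge0.
have B0 : 0 <= B by exact: rows_sq_ge0.
have mE := iidE.1.
have mG : measurable_fun setT G by exact: measurable_rows_sq.
have mW : measurable_fun setT W.
  rewrite /W; under eq_fun do rewrite -big_filter.
  apply: measurable_sum => S'; apply: measurable_funM => //.
  apply: measurableT_comp => //; apply: measurable_funM => //.
  by apply: measurable_funB => //; exact: measurable_rows_sq.
have pS0 : 0 <= pS.
  rewrite /pS; have := pen_mono r delta beta2 (leq0n #|S|) (leq_trans Sk kp).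
  by rewrite /pen [X in _ * X <= _]big_geq// mulr0.
apply: (@le_trans _ _ (\int[P]_w (D%:E *
    ((W w)%:E + ((B + pS)%:E + (G w)%:E))))%E).
  apply: ge0_le_integral => //.
  - move=> w _; rewrite lee_fin /frob2 sumr_ge0// => i _.
    by apply: sumr_ge0 => j _; exact: sqr_ge0.
  - exact/measurable_EFinP.
  - apply/measurable_EFinP; apply: measurable_funM => //.
    by do 2 apply: measurable_funD => //.
  - move=> w _; rewrite -!EFinD -EFinM lee_fin.
    have := minimizer_loss S beta2 d0 d1 (W0 w) (Hmin (Th + noise E w)).
    rewrite -/B -/pS -/(G w) => /(_ (rows_sq_le_excess _ _ beta2 r0)) /le_trans.
    by apply; rewrite ler_pM2l//; lra.
rewrite ge0_integralZl//; last 3 first.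
- by apply/measurable_EFinP; do 2 apply: measurable_funD => //.
- by move=> w _; rewrite -!EFinD lee_fin !addr_ge0.
- by rewrite lee_fin ltW.
rewrite ge0_integralD//; last 4 first.
- by move=> w _; rewrite lee_fin.
- exact/measurable_EFinP.
- by move=> w _; rewrite -EFinD lee_fin !addr_ge0.
- by apply/measurable_EFinP; apply: measurable_funD.
rewrite ge0_integralD//; last 3 first.
- by move=> w _; rewrite lee_fin addr_ge0.
- by move=> w _; rewrite lee_fin.
- exact/measurable_EFinP.
rewrite (_ : \int[P]_w (B + pS)%:E = (B + pS)%:E)%E; last first.
  by rewrite integral_cst// [X in (_ * X)%E]probability_setT mule1.
have -> : D * C * k%:R * (r%:R + L) = D * (C * Q) by rewrite /Q; ring.
rewrite [leRHS]EFinM lee_pmul2l ?lte_fin ?fin_numE//.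
apply: (@le_trans _ _ ((3 * r%:R * K)%:E +
    ((B + pS)%:E + (8 * (#|S|%:R * r%:R))%:E))%E).
  apply: leeD; first exact: integral_sum_excess_le.
  by rewrite leeD2lE//; exact: integral_rows_sq_le.
rewrite -!EFinD lee_fin.
have : r%:R * K <= Q * K by rewrite ler_wpM2r// ltW.
have : #|S|%:R * r%:R <= Q by apply: le_trans krQ; rewrite ler_wpM2r.
have : B <= c * (2 * beta * Q).
  by apply: le_trans tail _; rewrite ler_wpM2l// ltW.
rewrite /C; lra.
Qed.
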